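(* Let $\{X_n\}_{n\geq 0}$ be a stochastic process and $\xi_i^{(n)}$ ($i\geq 1$, $n\geq 1$) random variables such that $$X_{n+1}=\sum_{i=1}^{X_n}\xi_i^{(n+1)}\qquad\text{for all } n\geq 0,$$ where (1) $X_0$ is a positive integer constant; (2) each $X_n$ takes values in the set of positive integers; (3) the $\xi_i^{(n)}$ are independent and identically distributed; (4) $X_n$ is independent of the family $(\xi_i^{(k)})_{i\geq 1,\,k>n}$ for every $n$. Let $f_n$ be the probability function of $X_n$ and $f_\xi$ the common probability function of the $\xi_i^{(n)}$. Then, as $n\to\infty$, $f_n$ converges (pointwise) to a function $f^{\star}$ on the positive integers satisfying, for every positive integer $j$, $$\sum_{k\neq j}f^{\star}(k)\,f_\xi^{*k}(j)-f^{\star}(j)\left(1-f_\xi^{*j}(j)\right)=0.$$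
   Context: The probability function of a discrete random variable $Y$ is $y\mapsto P[Y=y]$. $f_\xi^{*k}$ denotes the $k$-fold convolution of $f_\xi$ with itself, i.e. the probability function of the sum of $k$ independent copies of $\xi$. The sum over $k\neq j$ runs over positive integers $k$. *)

(* Defs.v *)
From HB Require Import structures.
From mathcomp Require Import all_boot all_order all_algebra finmap.
From mathcomp Require Import all_classical all_reals all_analysis.

Set Implicit Arguments.
Unset Strict Implicit.
Unset Printing Implicit Defensive.

Import Order.TTheory GRing.Theory Num.Theory.

Local Open Scope classical_set_scope.
Local Open Scope ring_scope.

Section independence.
Context (d : measure_display) (T : measurableType d) (R : realType)
  (P : probability T R).

Definition mutually_independent (d' : measure_display) (T' : measurableType d')
    (I : choiceType) (D : set I) (Y : I -> {RV P >-> T'}) : Prop :=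
  forall (J : {fset I}) (B : I -> set T'),
    [set` J] `<=` D -> (forall i, measurable (B i)) ->
    P (\bigcap_(i in [set` J]) (Y i @^-1` B i)) =
      (\prod_(i <- J) P (Y i @^-1` B i))%E.

Definition identically_distributed (d' : measure_display)
    (T' : measurableType d') (I : Type) (D : set I) (Y : I -> {RV P >-> T'}) :
    Prop :=
  forall i j : I, D i -> D j ->
    forall B : set T', measurable B ->
      distribution P (Y i) B = distribution P (Y j) B.

Definition sigma_family (d' : measure_display) (T' : measurableType d')
    (I : Type) (D : set I) (Y : I -> {RV P >-> T'}) : set (set T) :=
  <<s \bigcup_(i in D) preimage_set_system setT (Y i) measurable >>.

Definition independent_of_family (d1 d2 : measure_display)
    (T1 : measurableType d1) (T2 : measurableType d2) (X : {RV P >-> T1})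
    (I : Type) (D : set I) (Y : I -> {RV P >-> T2}) : Prop :=
  forall A B : set T,
    preimage_set_system setT X measurable A -> sigma_family D Y B ->
    P (A `&` B) = (P A * P B)%E.

End independence.

(* [{RV P >-> T'}] unfolds to a type that does not mention [P]. *)
Arguments mutually_independent {d T R} P {d' T' I} D Y.
Arguments identically_distributed {d T R} P {d' T' I} D Y.
Arguments sigma_family {d T R} P {d' T' I} D Y _.
Arguments independent_of_family {d T R} P {d1 d2 T1 T2} X {I} D Y.

Section convolution.
Context (R : realType).

(* Convolution of two probability functions on the line: the sum over all reals
   [x] has at most countably many nonzero terms and is at most 1, so that [fine]
   loses nothing. *)
Definition convolution (f g : R -> R) (y : R) : R :=
  fine (\esum_(x in [set: R]) (f x * g (y - x))%:E).

(* [f * (f * ... * f)] with [k] factors; for [k = 0], the unit mass at 0. *)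
Definition convolution_power (f : R -> R) (k : nat) : R -> R :=
  iterop k convolution f (fun y => (y == 0)%:R).

End convolution.

(* Main.v *)
(* No atom of [xi] lies below 1: an atom [v < 1] would make [X] follow, with
   positive probability at each step, the values [x0 v^n], an impossible infinite
   descent among positive integers. Hence [X] is nondecreasing almost surely, the
   probabilities [P(X_n <= j)] decrease with [n], and [f_n(j)], a difference of two
   of them, converges. Conditioning on [X_n] gives
   [f_(n+1)(j) = sum_k f_n(k) f_xi^{*k}(j)], where only the terms [k <= j] survive,
   so the limit passes through this finite sum. *)

Require Import Defs.
From HB Require Import structures.
From mathcomp Require Import all_boot all_order all_algebra finmap.
From mathcomp Require Import all_classical all_reals all_analysis.
From mathcomp Require Import ring lra.

Set Implicit Arguments.
Unset Strict Implicit.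
Unset Printing Implicit Defensive.

Import Order.TTheory GRing.Theory Num.Theory.
Import numFieldNormedType.Exports.

Local Open Scope classical_set_scope.
Local Open Scope ring_scope.

(** * Sums over arbitrary index sets, and a measure split along fibers *)

Lemma ge0_esumZl (R : realType) (I : choiceType) (D : set I) (a : I -> \bar R)
    (c : R) : 0 <= c -> (forall i, 0 <= a i)%E ->
  (\esum_(i in D) (c%:E * a i) = c%:E * \esum_(i in D) a i)%E.
Proof.
rewrite le_eqVlt => /predU1P[<- _|c0 a0].
  by rewrite mul0e esum1// => i _; rewrite mul0e.
rewrite /esum -ereal_sup_pZl//; congr ereal_sup; apply/seteqP; split => x /=.
  move=> [F FD <-]; exists (\sum_(i \in F) a i)%E; first by exists F.
  by rewrite ge0_mule_fsumr.
by move=> [_ [F FD <-] <-]; exists F; rewrite // ge0_mule_fsumr.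
Qed.

Lemma esum_supported (R : realType) (I : choiceType) (D : set I)
    (a : I -> \bar R) : (forall i, ~ D i -> a i = 0%E) ->
  (\esum_(i in [set: I]) a i = \esum_(i in D) a i)%E.
Proof.
move=> a0; rewrite [RHS]esum_mkcond; apply: eq_esum => i _.
by case: ifPn => // /negP Di; rewrite a0// => /mem_set.
Qed.

(** Sigma-additivity, transported from [nat] to the values of [Z]. It serves to condition both on a
    real discrete variable and on [X n]. *)
Lemma measure_esum_fibers (d : measure_display) (T : measurableType d)
    (R : realType) (mu : {measure set T -> \bar R}) (T' : choiceType)
    (Z : T -> T') (E : set T) :
  countable (range Z) -> measurable E ->
  (forall x, measurable (Z @^-1` [set x])) ->
  (mu E = \esum_(x in [set: T']) mu (E `&` Z @^-1` [set x]))%E.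
Proof.
move=> /countable_injP[f finj] mE mZ.
(* The countable range numbers the fibers: [G n] is the part of [E] where the value of [Z] has
   number [n], and is empty when [n] numbers no value. *)
pose G n := E `&` [set w | f (Z w) = n].
have GE w : G (f (Z w)) = E `&` Z @^-1` [set Z w].
  congr (_ `&` _); apply/seteqP; split => w' /= => [|->//].
  by move=> fE; apply: finj fE; rewrite inE; [exists w'|exists w].
have G0 n : ~ (f @` range Z) n -> G n = set0.
  move=> Nn; apply/seteqP; split => // w [_ /= fw]; apply: Nn.
  by exists (Z w) => //; exists w.
have mG n : measurable (G n).
  have [[_ [w _ <-] <-]|/G0 ->//] := pselect ((f @` range Z) n).
  by rewrite GE; apply: measurableI.
have -> : E = \bigcup_n G n.
  by apply/seteqP; split => [w Ew|w [n _ []//]]; exists (f (Z w)).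
rewrite measure_semi_bigcup//; first last.
- exact: bigcup_measurable.
- apply/trivIsetP => i j _ _ ij; apply/seteqP; split => // w.
  by move=> [[_ /= fi] [_ /= fj]]; rewrite -fi -fj eqxx in ij.
rewrite nneseries_esumT// (esum_supported (D := f @` range Z)); last first.
  by move=> n /G0 ->; rewrite measure0.
rewrite esum_image => [|x y]; last exact: finj.
rewrite [RHS](esum_supported (D := range Z)); last first.
  move=> x Nx; rewrite (_ : _ `&` _ = set0) ?measure0//.
  by apply/seteqP; split => // w [_ /= Zw]; apply: Nx; exists w.
apply: eq_esum => _ [w _ <-]; rewrite GE; congr (mu (_ `&` _)).
by apply/seteqP; split => [w' Ew'|w' [n _ []//]]; exists (f (Z w')).
Qed.

(** * Convolution powers of a probability function *)

Section convolution_power.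
Context (R : realType).
Implicit Types f g : R -> R.

(** Since [g] is at most 1, the sum is dominated by that of [f], hence finite; this is what lets
    [fine] be removed. *)
Lemma convolution_fin f g y : (forall x, 0 <= f x) ->
  (\esum_(x in [set: R]) (f x)%:E <= 1)%E -> (forall x, 0 <= g x <= 1) ->
  (convolution f g y)%:E = (\esum_(x in [set: R]) (f x * g (y - x))%:E)%E /\
  0 <= convolution f g y <= 1.
Proof.
move=> f0 f1 g01.
have s0 : (0 <= \esum_(x in [set: R]) (f x * g (y - x))%:E)%E.
  apply: esum_ge0 => x _; rewrite lee_fin mulr_ge0//.
  by case/andP: (g01 (y - x)).
have s1 : (\esum_(x in [set: R]) (f x * g (y - x))%:E <= 1)%E.
  apply: le_trans f1; apply: le_esum => x _; rewrite lee_fin ler_piMr//.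
  by case/andP: (g01 (y - x)).
have sfin : (\esum_(x in [set: R]) (f x * g (y - x))%:E)%E \is a fin_num.
  by rewrite ge0_fin_numE// (le_lt_trans s1)// ltry.
by rewrite /convolution -!lee_fin fineK// s0 s1.
Qed.

(** [iterop] stops at [f] itself for one factor, so the only case with content is [k = 0]:
    convolving with the unit mass at 0 gives back [f]. *)
Lemma convolution_powerS f k : (forall x, 0 <= f x) ->
  convolution_power f k.+1 = convolution f (convolution_power f k).
Proof.
move=> f0; case: k => // ; apply/funext => y.
rewrite /convolution_power/= /convolution (esum_supported (D := [set y])).
  by rewrite esum_set1 subrr eqxx mulr1// lee_fin.
by move=> x /= yx; rewrite subr_eq0 eq_sym; case: eqP => // _; rewrite mulr0.
Qed.

Lemma convolution_power_itv f k y : (forall x, 0 <= f x) ->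
  (\esum_(x in [set: R]) (f x)%:E <= 1)%E ->
  0 <= convolution_power f k y <= 1.
Proof.
move=> f0 f1; elim: k y => [|k IH] y.
  by rewrite /convolution_power/=; case: eqP; rewrite lexx ler01.
by rewrite convolution_powerS//; apply: (convolution_fin _ _ _ _).2.
Qed.

(** A sum of [k] terms, each at least 1, cannot fall below [k]: a first term [x >= 1] leaves
    [y - x < k - 1] to the other factors. *)
Lemma convolution_power_eq0 f k y : (forall x, 0 <= f x) ->
  (forall x, x < 1 -> f x = 0) -> y < k%:R -> convolution_power f k y = 0.
Proof.
move=> f0 f1; elim: k y => [|k IH] y yk.
  by rewrite /convolution_power/= lt_eqF.
rewrite convolution_powerS// /convolution esum1// => x _.
have [/f1 ->|x1] := ltP x 1; first by rewrite mul0r.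
by rewrite IH ?mulr0//; move: yk; rewrite -natr1; lra.
Qed.

End convolution_power.

(** * Law of a sum of independent discrete variables *)

Section discrete_sum.
Context (d : measure_display) (T : measurableType d) (R : realType)
  (P : probability T R).

Lemma esum_pmf (Y : {dRV P >-> R}) :
  (\esum_(x in [set: R]) (pmf (P := P) Y x)%:E = 1)%E.
Proof.
rewrite -(probability_setT P) (measure_esum_fibers P (Z := Y))//.
- by apply: eq_esum => x _; rewrite setTI fineK// fin_num_measure.
- exact: countable_range.
Qed.

(* Only the joint law of the whole family with [E] is prescribed, and [c] need
   not be [P E], so that the induction can absorb the event [Y i = x] into [E]
   and the factor [f x] into [c]. *)
Lemma prob_sum_convolution_power (I : eqType) (Y : I -> {dRV P >-> R})
    (f : R -> R) (s : seq I) (E : set T) (c z : R) :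
  (forall x, 0 <= f x) -> (\esum_(x in [set: R]) (f x)%:E <= 1)%E ->
  uniq s -> measurable E -> 0 <= c ->
  (forall v : I -> R, P (E `&` [set w | {in s, forall i, Y i w = v i}]) =
    (c * \prod_(i <- s) f (v i))%:E) ->
  P (E `&` [set w | \sum_(i <- s) Y i w = z]) =
    (c * convolution_power f (size s) z)%:E.
Proof.
move=> f0 f1; elim: s E c z => [|i s IH] E c z.
  move=> _ mE c0 /(_ (fun=> 0)); rewrite big_nil mulr1 => PE.
  rewrite /convolution_power/= [X in _ `&` X](_ : _ = [set _ | z = 0]);
    last by apply/seteqP; split => w /=; rewrite big_nil.
  case: eqP => [z0|z0]; rewrite ?mulr1 ?mulr0.
    rewrite -PE; congr (P (_ `&` _)).
    by apply/seteqP; split.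
  by rewrite (_ : _ `&` _ = set0) ?measure0//; apply/seteqP; split => // w [].
rewrite cons_uniq => /andP[si us] mE c0 PE.
have mS t x : measurable [set w | \sum_(j <- t) Y j w = x].
  have mf : measurable_fun setT (fun w => \sum_(j <- t) Y j w).
    by apply: measurable_sum => j; exact: measurable_funPT.
  by rewrite -[X in measurable X]setTI; exact: (mf measurableT [set x]).
have sumE w : \sum_(j <- i :: s) Y j w = Y i w + \sum_(j <- s) Y j w.
  by rewrite big_cons.
rewrite (measure_esum_fibers P (Z := Y i)); first last.
- by move=> x; exact: measurable_funPTI.
- exact: measurableI.
- exact: countable_range.
have g01 y := convolution_power_itv (size s) y f0 f1.
have [cE _] := convolution_fin z f0 f1 g01.
rewrite convolution_powerS// EFinM cE -ge0_esumZl//; last first.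
  by move=> x; rewrite lee_fin mulr_ge0//; case/andP: (g01 (z - x)).
apply: eq_esum => x _.
rewrite -EFinM mulrA -(IH (E `&` Y i @^-1` [set x])) ?mulr_ge0//.
- congr (P _); apply/seteqP; split => w /=.
    by move=> [[Ew]]; rewrite sumE => <- ->; split => //; ring.
  by move=> [[Ew Yi] zE]; split => //; split => //; rewrite sumE Yi zE; ring.
(* The pattern [v] on [s] is completed by the value [x] at [i]; as [i] is not in [s], the product
   over [s] is unchanged. *)
- move=> v; pose v' j := if j == i then x else v j.
  have v'i : v' i = x by rewrite /v' eqxx.
  have vs j : j \in s -> v' j = v j.
    by move=> js; rewrite /v'; case: eqP => // ji; rewrite -ji js in si.
  have <- : \prod_(j <- s) f (v' j) = \prod_(j <- s) f (v j).
    by apply: eq_big_seq => j /vs ->.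
  have := PE v'; rewrite big_cons v'i mulrA => <-.
  rewrite -setIA; congr (P (_ `&` _)); apply/seteqP; split => w /=.
    move=> [Yi Ys] j; rewrite inE => /predU1P[->|js]; first by rewrite v'i.
    by rewrite vs//; exact: Ys.
  move=> Ys; split; first by rewrite Ys ?mem_head.
  by move=> j js; rewrite Ys -?vs// in_cons js orbT.
Qed.

(** A pattern on a finite list is a finite intersection of generators. This makes it eligible for
    [independent_of_family]. *)
Lemma sigma_family_pattern (I : eqType) (D : set I) (Y : I -> {RV P >-> R})
    (s : seq I) (v : I -> R) : (forall i, i \in s -> D i) ->
  sigma_family P D Y [set w | {in s, forall i, Y i w = v i}].
Proof.
set F := sigma_family P D Y.
have [FT _ _ FI] : [/\ F setT, setSD_closed F, ndseq_closed F & setI_closed F].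
  apply/sigma_algebraP; first by [].
  exact: smallest_sigma_algebra.
elim: s => [|i s IH] sD.
  by rewrite (_ : [set _ | _] = setT)//; apply/seteqP; split.
rewrite (_ : [set _ | _] =
    Y i @^-1` [set v i] `&` [set w | {in s, forall j, Y j w = v j}]).
  apply: FI.
    apply: sub_sigma_algebra; exists i; first by apply: sD; rewrite mem_head.
    by exists [set v i]; rewrite ?setTI.
  by apply: IH => j js; apply: sD; rewrite in_cons js orbT.
apply/seteqP; split => w /=.
  move=> Ys; split; first by rewrite Ys ?mem_head.
  by move=> j js; rewrite Ys// in_cons js orbT.
by move=> [Yi Ys] j; rewrite inE => /predU1P[->|/Ys].
Qed.

Lemma sigma_family_measurable (I : Type) (D : set I) (Y : I -> {RV P >-> R}) :
  sigma_family P D Y `<=` measurable.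
Proof.
apply: smallest_sub; first exact: sigma_algebra_measurable.
by move=> _ [i _ [B mB <-]]; rewrite setTI; exact: measurable_funPTI.
Qed.

Lemma mutually_independent_pattern (I : choiceType) (D : set I)
    (Y : I -> {RV P >-> R}) (s : seq I) (v : I -> R) :
  mutually_independent P D Y -> uniq s -> (forall i, i \in s -> D i) ->
  P [set w | {in s, forall i, Y i w = v i}] =
    (\prod_(i <- s) P (Y i @^-1` [set v i]))%E.
Proof.
move=> indep us sD.
have sJ : perm_eq [fset i in s]%fset s.
  by apply: uniq_perm => // i; rewrite !inE.
rewrite -(perm_big _ sJ)/= -(indep _ (fun i => [set v i])); last 2 first.
- by move=> i /=; rewrite (perm_mem sJ) => /sD.
- by move=> i; exact: measurable_set1.
congr (P _); apply/seteqP; split => w /= Ys i /=.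
  by rewrite (perm_mem sJ) => /Ys.
by move=> js; apply: Ys; rewrite /= (perm_mem sJ).
Qed.

End discrete_sum.

(** * The process: transition law, monotonicity and passage to the limit *)

Section branching_process.
Context (d : measure_display) (T : measurableType d) (R : realType)
  (P : probability T R) (X : nat -> {RV P >-> nat})
  (xi : nat -> nat -> {dRV P >-> R}) (x0 : nat)
  (hX0 : forall w : T, X 0%N w = x0)
  (hXpos : forall (n : nat) (w : T), (0 < X n w)%N)
  (hrec : forall (n : nat) (w : T),
    (X n.+1 w)%:R = \sum_(1 <= i < (X n w).+1) xi n.+1 i w)
  (hindep : mutually_independent P
    [set p : nat * nat | (1 <= p.1)%N /\ (1 <= p.2)%N]
    (fun p : nat * nat => xi p.1 p.2 : {RV P >-> R}))
  (hident : identically_distributed P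
    [set p : nat * nat | (1 <= p.1)%N /\ (1 <= p.2)%N]
    (fun p : nat * nat => xi p.1 p.2 : {RV P >-> R}))
  (hXindep : forall n : nat, independent_of_family P (X n)
    [set p : nat * nat | (n < p.1)%N /\ (1 <= p.2)%N]
    (fun p : nat * nat => xi p.1 p.2 : {RV P >-> R})).

Let f (n j : nat) : R := fine (P (X n @^-1` [set j])).
Let F (n j : nat) : R := fine (P (X n @^-1` [set i | (i <= j)%N])).
Let fxi : R -> R := pmf (P := P) (xi 1%N 1%N).

Let fE n j : P (X n @^-1` [set j]) = (f n j)%:E.
Proof. by rewrite fineK// fin_num_measure//; exact: measurable_funPTI. Qed.

Let f_ge0 n j : 0 <= f n j.
Proof. exact: fine_ge0. Qed.

Let f0 n : f n 0 = 0.
Proof.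
rewrite /f (_ : _ @^-1` _ = set0) ?measure0//.
by apply/seteqP; split => // w /= Xw; have := hXpos n w; rewrite Xw.
Qed.

Let fxi_ge0 x : 0 <= fxi x.
Proof. exact: pmf_ge0. Qed.

Let fxi_le1 : (\esum_(x in [set: R]) (fxi x)%:E <= 1)%E.
Proof. by rewrite esum_pmf. Qed.

(** This is the joint law required by [prob_sum_convolution_power], with [X n = k] as event and
    [f n k] as constant. Independence of [X n] from later offspring splits off [f n k]; the
    offspring being i.i.d. turns the rest into a product of values of [fxi]. *)
Lemma joint_offspring_pattern n k (v : nat -> R) :
  P (X n @^-1` [set k] `&`
      [set w | {in index_iota 1 k.+1, forall i, xi n.+1 i w = v i}]) =
  (f n k * \prod_(1 <= i < k.+1) fxi (v i))%:E.
Proof.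
(* The independence hypotheses are indexed by pairs, so the offspring of generation [n.+1] are
   relabelled accordingly. *)
pose s := [seq (n.+1, i) | i <- index_iota 1 k.+1].
pose u (p : nat * nat) := v p.2.
have sD p : p \in s -> p.1 = n.+1 /\ (0 < p.2)%N.
  by move=> /mapP[i]; rewrite mem_index_iota => /andP[i0 _] ->.
have -> : [set w | {in index_iota 1 k.+1, forall i, xi n.+1 i w = v i}] =
    [set w | {in s, forall p, xi p.1 p.2 w = u p}].
  apply/seteqP; split => w /= h.
    by move=> _ /mapP[i ik ->]; exact: h.
  by move=> i ik; rewrite -[v i]/(u (n.+1, i)) -h//; exact: map_f.
rewrite (hXindep (n := n)); first last.
- apply: (sigma_family_pattern
    (Y := fun p : nat * nat => xi p.1 p.2 : {RV P >-> R})).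
  by move=> p /sD[p1 p2] /=; rewrite p1.
- by exists [set k]; rewrite ?setTI.
rewrite fE EFinM; congr (_ * _)%E.
rewrite (mutually_independent_pattern u hindep).
- rewrite big_map -prodEFin; apply: eq_big_seq => i.
  rewrite mem_index_iota => /andP[i0 _].
  have := @hident (n.+1, i) (1%N, 1%N) _ _ _ (measurable_set1 (v i)).
  rewrite /distribution /pushforward /= => -> //.
  by rewrite /fxi /pmf fineK// fin_num_measure//; exact: measurable_funPTI.
- by rewrite map_inj_uniq ?iota_uniq// => i j [].
- by move=> p /sD[p1 p2] /=; rewrite p1.
Qed.

(** On [X n = k] the recursion has exactly [k] summands, so [X n.+1 = j] says that their sum is
    [j]. *)
Lemma joint_transition n k j :
  P (X n @^-1` [set k] `&` X n.+1 @^-1` [set j]) =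
  (f n k * convolution_power fxi k j%:R)%:E.
Proof.
have := @prob_sum_convolution_power _ _ _ P _ (xi n.+1) fxi (index_iota 1 k.+1)
  (X n @^-1` [set k]) (f n k) j%:R fxi_ge0 fxi_le1 (iota_uniq _ _) _ (f_ge0 n k)
  (joint_offspring_pattern n k).
rewrite size_iota subn1/= => <-; last exact: measurable_funPTI.
congr (P _); apply/seteqP; split => w /= [Xk].
  by move=> Xj; split => //; rewrite -Xj hrec Xk.
by rewrite -{1}Xk -hrec => /eqP; rewrite eqr_nat => /eqP.
Qed.

Lemma offspring_pmf_lt1 x : x < 1 -> fxi x = 0.
Proof.
move=> x1; apply/eqP; apply: contrapT => /negP fx0.
(* Strong induction on [m] for all [n] at once, because each descent advances time by one step. *)
have descent m n : f n m != 0 -> False.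
  elim/ltn_ind: m n => m IH n fm.
  (* [E] is the event that [X n = m] and its [m] offspring all equal [x]. It has positive
     probability, and on it [X n.+1] is the constant [m x], smaller than [m]. *)
  have := joint_offspring_pattern n m (fun=> x); set E := (X in P X) => PE.
  have PE0 : (0 < P E)%E.
    rewrite PE lte_fin mulr_gt0 ?prodr_gt0// => [|i _].
      by rewrite lt_neqAle eq_sym fm f_ge0.
    by rewrite lt_neqAle eq_sym fx0 fxi_ge0.
  have XE w : E w -> (X n.+1 w)%:R = x *+ m.
    move=> [/= Xm xm]; rewrite hrec Xm.
    rewrite (eq_big_seq (fun=> x)) => [|i /xm//].
    by rewrite sumr_const_nat subn1.
  (* A point of [E] exhibits that constant as a natural number, to which the induction hypothesis
     applies. *)
  have [w Ew] : E !=set0.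
    by apply/set0P; apply: contraTneq PE0 => ->; rewrite measure0 ltxx.
  have mE : measurable E.
    apply: measurableI; first exact: measurable_funPTI.
    apply: (@sigma_family_measurable _ _ _ P _ setT (xi n.+1)).
    exact: sigma_family_pattern.
  apply: (IH (X n.+1 w) _ n.+1).
    have m0 : (0 < m)%N by case: Ew => /= <- _; exact: hXpos.
    by rewrite -(ltr_nat R) XE// -(mulr_natr x) gtr_pMl// ltr0n.
  rewrite gt_eqF// -lte_fin -fE (lt_le_trans PE0)// le_measure ?inE//.
    exact: measurable_funPTI.
  by move=> w' Ew'; apply/eqP; rewrite -(eqr_nat R) !XE.
(* The descent starts at [x0], the value of [X 0] with probability 1. *)
apply: (@descent x0 0%N); rewrite /f (_ : _ @^-1` _ = setT).
  by rewrite probability_setT oner_neq0.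
by apply/seteqP; split => // w _ /=; rewrite hX0.
Qed.

Let convolution_power_lt k j : (j < k)%N -> convolution_power fxi k j%:R = 0.
Proof.
move=> jk; apply: convolution_power_eq0 => //; first exact: offspring_pmf_lt1.
by rewrite ltr_nat.
Qed.

Let fibers n E : measurable E ->
  (P E = \esum_(k in [set: nat]) P (E `&` X n @^-1` [set k]))%E.
Proof.
move=> mE; apply: measure_esum_fibers => //; first exact: countableP.
by move=> k; exact: measurable_funPTI.
Qed.

Lemma pmf_recurrence n j :
  f n.+1 j = \sum_(1 <= k < j.+1) f n k * convolution_power fxi k j%:R.
Proof.
apply: EFin_inj; rewrite -fE (fibers n); last exact: measurable_funPTI.
under eq_esum do rewrite setIC joint_transition.
have a0 k : (0 <= (f n k * convolution_power fxi k j%:R)%:E)%E.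
  by rewrite -joint_transition.
(* The terms with [k > j] vanish because no offspring value below 1 has mass; the term [k = 0]
   vanishes because [X n] is positive. *)
rewrite -nneseries_esumT// (nneseries_split 0 j.+1)// add0n.
rewrite eseries0 => [|k jk _]; last by rewrite convolution_power_lt ?mulr0.
by rewrite adde0 big_ltn// f0 mul0r add0e sumEFin.
Qed.

(** The two probabilities are compared fiber by fiber over [X n = k]. For [k <= j] the fiber lies
    wholly in [X n <= j]; for [k > j] the event [X n.+1 <= j] is null on it. *)
Lemma cdf_nonincreasing j : nonincreasing_seq (F ^~ j).
Proof.
apply/nonincreasing_seqP => n; rewrite fine_le ?fin_num_measure//;
  try exact: measurable_funPTI.
rewrite (fibers n); last exact: measurable_funPTI.
rewrite [leRHS](fibers n); last exact: measurable_funPTI.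
apply: le_esum => k _; have [kj|jk] := leqP k j.
  rewrite le_measure ?inE//;
    try by apply: measurableI; exact: measurable_funPTI.
  by move=> w [/= _ Xk]; split; rewrite //= Xk.
(* A second split, by the value [i] of [X n.+1], reduces nullity to the transitions from [k] to
   [i <= j < k]. *)
rewrite (fibers n.+1); last by apply: measurableI; exact: measurable_funPTI.
rewrite esum1// => i _; have [ij|ji] := leqP i j.
  apply/eqP; rewrite -measure_le0.
  have <- : P (X n @^-1` [set k] `&` X n.+1 @^-1` [set i]) = 0%E.
    by rewrite joint_transition convolution_power_lt ?mulr0// (leq_ltn_trans ij).
  rewrite le_measure ?inE//;
    try by do ?apply: measurableI; exact: measurable_funPTI.
  by move=> w [[_ /= Xk] /= Xi]; split.
rewrite (_ : _ `&` _ = set0) ?measure0//; apply/seteqP; split => // w.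
by move=> [[/= + _] Xi]; rewrite Xi leqNgt ji.
Qed.

Lemma pmf_cvg j : cvgn (f ^~ j).
Proof.
case: j => [|j].
  by rewrite (_ : f ^~ 0%N = cst 0); [exact: is_cvg_cst|exact/funext/f0].
have -> : f ^~ j.+1 = F ^~ j.+1 \- F ^~ j.
  apply/funext => n /=; rewrite /F.
  have -> : X n @^-1` [set i | (i <= j.+1)%N] =
      X n @^-1` [set i | (i <= j)%N] `|` X n @^-1` [set j.+1].
    apply/seteqP; split => w /=.
      by rewrite leq_eqVlt => /predU1P[->|]; [right|left].
    by case=> [/leqW//|->].
  rewrite measureU; try exact: measurable_funPTI.
    rewrite fineD ?fin_num_measure//; try exact: measurable_funPTI.
    by rewrite addrC addKr.
  by apply/seteqP; split => // w [/= + Xj]; rewrite Xj ltnn.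
have cF i : cvgn (F ^~ i).
  apply: nonincreasing_is_cvgn; first exact: cdf_nonincreasing.
  by exists 0 => _ [n _ <-]; exact: fine_ge0.
exact: is_cvgB.
Qed.

Lemma limit_pmf_stationary j :
  limn (f ^~ j) =
  \sum_(1 <= k < j.+1) limn (f ^~ k) * convolution_power fxi k j%:R.
Proof.
(* The shifted sequence is evaluated twice: it keeps the limit of the original one, and by the
   recurrence it converges to the finite sum of limits. *)
apply: (@cvg_unique _ _ (f n.+1 j @[n --> \oo])) => //.
  have := pmf_cvg (j := j); rewrite -(cvg_shiftn 1).
  by under eq_fun do rewrite addn1.
rewrite (funext (fun n => pmf_recurrence n j)).
apply: cvg_big => [|k _]; first exact: add_continuous.
by apply: cvgM; [exact: pmf_cvg|exact: cvg_cst].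
Qed.

(** The series stops at [k = j], since higher convolution powers vanish at [j]. The equation is then
    stationarity with the term [k = j] moved to the other side. *)
Lemma limit_pmf_balance j : (0 < j)%N ->
  (\sum_(1 <= k <oo | k != j)
      (limn (f ^~ k) * convolution_power fxi k j%:R)%:E
    - (limn (f ^~ j) * (1 - convolution_power fxi j j%:R))%:E = 0)%E.
Proof.
move=> j0; rewrite (nneseries_split_cond _ j) => [|k _]; last first.
  rewrite lee_fin mulr_ge0//.
    by apply: limr_ge; [exact: pmf_cvg|exact: nearW].
  by case/andP: (convolution_power_itv k j%:R fxi_ge0 fxi_le1).
rewrite add1n eseries0 => [|k jk _]; last first.
  by rewrite convolution_power_lt ?mulr0.
rewrite adde0 sumEFin -EFinB; congr EFin.
have := limit_pmf_stationary j.
rewrite (bigD1_seq j)/= ?iota_uniq// ?mem_index_iota ?j0//=.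
lra.
Qed.

End branching_process.

Theorem proposition9 (d : measure_display) (T : measurableType d)
    (R : realType) (P : probability T R)
    (X : nat -> {RV P >-> nat})
    (xi : nat -> nat -> {dRV P >-> R})
    (x0 : nat)
    (hx0 : (0 < x0)%N)
    (hX0 : forall w : T, X 0%N w = x0)
    (hXpos : forall (n : nat) (w : T), (0 < X n w)%N)
    (hrec : forall (n : nat) (w : T),
      (X n.+1 w)%:R = \sum_(1 <= i < (X n w).+1) xi n.+1 i w)
    (hindep : mutually_independent P
      [set p : nat * nat | (1 <= p.1)%N /\ (1 <= p.2)%N]
      (fun p : nat * nat => xi p.1 p.2 : {RV P >-> R}))
    (hident : identically_distributed P
      [set p : nat * nat | (1 <= p.1)%N /\ (1 <= p.2)%N]
      (fun p : nat * nat => xi p.1 p.2 : {RV P >-> R}))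
    (hXindep : forall n : nat, independent_of_family P (X n)
      [set p : nat * nat | (n < p.1)%N /\ (1 <= p.2)%N]
      (fun p : nat * nat => xi p.1 p.2 : {RV P >-> R})) :
  let f (n j : nat) : R := fine (P (X n @^-1` [set j])) in
  let fxi : R -> R := pmf (P := P) (xi 1%N 1%N) in
  exists fstar : nat -> R,
    (forall j : nat, (0 < j)%N -> f n j @[n --> \oo] --> fstar j) /\
    (forall j : nat, (0 < j)%N ->
      (\sum_(1 <= k <oo | k != j)
          (fstar k * convolution_power fxi k j%:R)%:E
        - (fstar j * (1 - convolution_power fxi j j%:R))%:E = 0)%E).
Proof.
move=> f fxi; exists (fun j => limn (f ^~ j)); split => j j0.
  exact: (pmf_cvg hX0 hXpos hrec hindep hident hXindep).
exact: (limit_pmf_balance hX0 hXpos hrec hindep hident hXindep).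
Qed.
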